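(* A $2$-layer fan-planar graph with $n$ vertices has at most $2n-4$ edges, and this bound is tight for $n \geq 3$.
   Context: All graphs are simple (no loops, no multiple edges). A drawing of a graph maps each vertex to a distinct point of the plane and each edge to a simple Jordan arc joining the points of its end-vertices. Only simple drawings are considered: the arcs of any two distinct edges have at most one point in common, which is either a common end-vertex or a common interior point where the two arcs properly cross. Two edges are independent if they share no end-vertex. A fan-planar drawing is a (simple) drawing such that: (a) no edge is crossed by two independent edges; (b) there are no two adjacent edges $(u,v)$, $(u,w)$ that cross an edge $e$ from different sides while moving from $u$ to $v$ and from $u$ to $w$. A $2$-layer fan-planar drawing is a fan-planar drawing such that (i) each vertex is drawn on one of two distinct horizontal lines, called layers, and (ii) each edge connects vertices of different layers and is drawn as a vertically monotone curve. A $2$-layer fan-planar graph is a graph that admits a $2$-layer fan-planar drawing.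
   Formalization: The upper bound 2n-4 is stated only for n ≥ 3, like the tightness: for n = 2 a single edge (K_2) is a 2-layer fan-planar graph with 1 > 0 edges, and for n = 1 the bound is negative. *)

(* Defs.v *)
(* MathComp-Analysis; the plane is R * R for a realType R. *)
From mathcomp Require Import all_boot all_order all_algebra.
From mathcomp Require Import all_classical all_reals all_analysis.

Set Implicit Arguments.
Unset Strict Implicit.
Unset Printing Implicit Defensive.

Import Order.TTheory GRing.Theory Num.Theory.
Import numFieldNormedType.Exports.

Local Open Scope classical_set_scope.
Local Open Scope ring_scope.

Definition simple_graph (V : finType) (adj : rel V) : Prop :=
  symmetric adj /\ irreflexive adj.

Definition edge_set (V : finType) (adj : rel V) : {set {set V}} :=
  [set [set xy.1; xy.2] | xy : V * V & adj xy.1 xy.2]%SET.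

Section Arcs.
Variable R : realType.
Implicit Types (f g h : R -> R * R) (H : R * R -> R * R) (p : R * R) (b : bool).

Definition jordan_arc f : Prop :=
  {within `[0, 1], continuous f} /\ {in `[0, 1] &, injective f}.

Definition plane_homeomorphism H : Prop :=
  continuous H /\
  exists G : R * R -> R * R, [/\ continuous G, cancel H G & cancel G H].

(* The two sides of a Jordan arc f are the images under H^-1 of the upper and
   the lower side of the segment [0, 1] x {0}. By the Schoenflies theorem a
   straightening H always exists, and two straightenings of f induce the same
   two sides locally along the interior of f, up to exchanging their names. *)
Definition straightens H f : Prop :=
  plane_homeomorphism H /\ {in `[0, 1], forall t, H (f t) = (t, 0)}.

(* The point p is interior to f and to g, and at p the arc g, traversed in the
   direction of its parametrization, passes from the upper (b = false) or the
   lower (b = true) side of f to the opposite side, with respect to H. *)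
Definition crosses_from_at H b f g p : Prop :=
  exists s t : R,
    [/\ s \in `]0, 1[, t \in `]0, 1[, f s = p & g t = p] /\
    (\forall x \near t^'-, 0 < (-1) ^+ b * (H (g x)).2) /\
    (\forall x \near t^'+, (-1) ^+ b * (H (g x)).2 < 0).

Definition properly_cross_at f g p : Prop :=
  exists H b, straightens H f /\ crosses_from_at H b f g p.

Definition cross f g : Prop := exists p, properly_cross_at f g p.

Definition cross_from_different_sides f g h : Prop :=
  [/\ cross f g, cross f h &
    forall H, straightens H f ->
      exists b p q, crosses_from_at H b f g p /\ crosses_from_at H (~~ b) f h q].

Definition vertically_monotone f : Prop :=
  {in `[0, 1] &, {homo (fun t => (f t).2) : s t / s < t}} \/
  {in `[0, 1] &, {homo (fun t => (f t).2) : s t / s < t >-> t < s}}.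

End Arcs.

Section Drawings.
Variables (R : realType) (V : finType) (adj : rel V).
Variables (pos : V -> R * R) (arc : V -> V -> R -> R * R).

(* arc u v parametrizes the edge uv from u to v; arc v u is the same arc
   traversed backwards. Values of arc at non-adjacent pairs are irrelevant. *)
Definition drawing : Prop :=
  injective pos /\
  forall u v, adj u v ->
    [/\ jordan_arc (arc u v), arc u v 0 = pos u, arc u v 1 = pos v &
        {in `[0, 1], forall t, arc v u t = arc u v (1 - t)}].

Definition on_edge (u v : V) (p : R * R) : Prop :=
  exists2 t : R, t \in `[0, 1] & arc u v t = p.

Definition simple_drawing : Prop :=
  drawing /\
  forall u v w z, adj u v -> adj w z -> [set u; v]%SET != [set w; z]%SET ->
    (forall p q, on_edge u v p -> on_edge w z p ->
                 on_edge u v q -> on_edge w z q -> p = q) /\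
    (forall p, on_edge u v p -> on_edge w z p ->
       (exists2 x, x \in ([set u; v] :&: [set w; z])%SET & p = pos x) \/
       properly_cross_at (arc u v) (arc w z) p).

Definition independent_edges (u v w z : V) : bool :=
  [disjoint [set u; v]%SET & [set w; z]%SET].

Definition fan_planar_drawing : Prop :=
  [/\ simple_drawing,
      (forall x y u v w z, adj x y -> adj u v -> adj w z ->
         cross (arc x y) (arc u v) -> cross (arc x y) (arc w z) ->
         ~~ independent_edges u v w z) &
      (forall x y u v w, adj x y -> adj u v -> adj u w -> v != w ->
         ~ cross_from_different_sides (arc x y) (arc u v) (arc u w))].

Definition two_layer_fan_planar_drawing : Prop :=
  fan_planar_drawing /\
  exists y1 y2 : R,
    [/\ y1 != y2,
        (forall v, (pos v).2 = y1 \/ (pos v).2 = y2) &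
        (forall u v, adj u v ->
           (pos u).2 != (pos v).2 /\ vertically_monotone (arc u v))].

End Drawings.

Definition two_layer_fan_planar (R : realType) (V : finType) (adj : rel V) :
    Prop :=
  exists (pos : V -> R * R) (arc : V -> V -> R -> R * R),
    two_layer_fan_planar_drawing adj pos arc.

(* Main.v *)
(* Upper bound: rank each vertex by its position in its layer and give an edge
   the sum of the ranks of its ends; this is at most n - 2. Two distinct edges
   of equal rank have their ends in opposite orders on the two layers, so they
   are independent and, by the intermediate value theorem, they cross. Three
   edges of equal rank would thus be pairwise independent and pairwise crossing,
   which condition (a) forbids. Hence each of the n - 1 ranks is used at most
   twice, and the extreme ranks 0 and n - 2 at most once: at most 2n - 4 edges.
   Tightness: the straight-line drawing of K_{2,n-2}. *)
Require Import Defs.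
From mathcomp Require Import all_boot all_order all_algebra.
From mathcomp Require Import all_classical all_reals all_analysis.
From mathcomp Require Import ring lra zify.

Set Implicit Arguments.
Unset Strict Implicit.
Unset Printing Implicit Defensive.

Import Order.TTheory GRing.Theory Num.Theory.
Import numFieldNormedType.Exports.

Local Open Scope classical_set_scope.
Local Open Scope ring_scope.

(** * Crossing edges *)

(** Meant for composing with a reparametrization [phi] of the unit interval, where nothing is known
    about [phi] or [g] outside it. *)
Lemma within_continuous_comp_homo (R : realType) (A B : set R)
    (phi g : R -> R) :
  {within A, continuous phi} -> {within B, continuous g} ->
  {homo phi : x / A x >-> B x} -> {within A, continuous (g \o phi)}.
Proof.
move=> /subspace_continuousP cphi /subspace_continuousP cg phiAB.
apply/subspace_continuousP => x Ax P NP.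
have := cphi _ Ax _ (cg _ (phiAB _ Ax) _ NP); rewrite /= !near_simpl.
apply: filter_app; near=> y => h; apply: h; apply: phiAB.
by near: y; exact: withinT.
Unshelve. all: by end_near. Qed.

Section Meet.
Variable R : realType.
Implicit Types f g : R -> R * R.

(** Both curves rise through the same range of heights. The horizontal gap between their points of
    equal height is continuous and changes sign, so it vanishes somewhere. *)
Lemma increasing_curves_meet f g :
  {within `[0, 1], continuous f} -> {within `[0, 1], continuous g} ->
  {in `[0, 1] &, {homo (fun t => (f t).2) : s t / s < t}} ->
  {in `[0, 1] &, {homo (fun t => (g t).2) : s t / s < t}} ->
  (f 0).2 = (g 0).2 -> (f 1).2 = (g 1).2 ->
  (f 0).1 < (g 0).1 -> (g 1).1 < (f 1).1 ->
  exists s t : R, [/\ s \in `[0, 1], t \in `[0, 1] & f s = g t].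
Proof.
move=> cf cg incf incg e0 e1 lt0 lt1.
have coord (h : R -> R * R) : {within `[0, 1], continuous h} ->
    {within `[0, 1], continuous (fun t => (h t).1)} /\
    {within `[0, 1], continuous (fun t => (h t).2)} :> Prop.
  move=> ch; split; apply: (@within_continuous_comp _ _ _ _ h) => // x _.
    exact: cvg_fst.
  exact: cvg_snd.
have [[cf1 cf2] [cg1 cg2]] := (coord _ cf, coord _ cg).
have m0 : (0 : R) \in `[0, 1] by rewrite in_itv /= lexx ler01.
have m1 : (1 : R) \in `[0, 1] by rewrite in_itv /= lexx ler01.
have mono (h : R -> R * R) :
    {in `[0, 1] &, {homo (fun t => (h t).2) : s t / s < t}} ->
    {in `[0, 1] &, {mono (fun t : R => (h t).2 : R) : s t / s <= t}}.
  exact: le_mono_in.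
have [mf mg] := (mono _ incf, mono _ incg).
have ig := inc_inj_in mg.
have surj (h k : R -> R * R) :
    {within `[0, 1], continuous (fun t => (k t).2)} ->
    {in `[0, 1] &, {mono (fun t : R => (h t).2 : R) : s t / s <= t}} ->
    (h 0).2 = (k 0).2 -> (h 1).2 = (k 1).2 -> forall s : R, s \in `[0, 1] ->
    exists2 t : R, t \in `[0, 1] & (k t).2 = (h s).2.
  move=> ck mh eq0 eq1 s ms; apply: IVT => //.
  have /andP[s0 s1] : 0 <= s <= 1 by rewrite in_itv in ms.
  by rewrite -eq0 -eq1 ge_min le_max !mh // s0 s1 orbT.
(* Compare f s with the point g (phi s) of g at the same height. *)
have phiP (s : R) : exists t,
    s \in `[0, 1] -> t \in `[0, 1] /\ (g t).2 = (f s).2.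
  (* Outside the unit interval 0 is a mere placeholder. *)
  have [ms|nms] := boolP (s \in `[0, 1]); last by exists 0.
  by have [t ? ?] := surj _ _ cg2 mf e0 e1 s ms; exists t.
pose phi s := projT1 (cid (phiP s)).
have [mphi ephi] : (forall s, s \in `[0, 1] -> phi s \in `[0, 1]) /\
    (forall s, s \in `[0, 1] -> (g (phi s)).2 = (f s).2).
  by split=> s; rewrite /phi; case: cid => t /= /[apply] -[].
have phi0 : phi 0 = 0 by apply: ig => //; [exact: mphi | rewrite ephi].
have phi1 : phi 1 = 1 by apply: ig => //; [exact: mphi | rewrite ephi].
have cphi : {within `[0, 1], continuous phi}.
  (* Continuity comes from monotonicity and surjectivity: heights increase along both curves, and
     [surj] with [f] and [g] exchanged gives preimages. *)
  apply: segment_inc_surj_continuous.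
    by move=> s t ms mt; rewrite -mg ?mphi // !ephi // mf.
  rewrite phi0 phi1 => t /= mt.
  have [s ms es] := surj _ _ cf2 mg (esym e0) (esym e1) t mt.
  by exists s => //; apply: ig => //; [exact: mphi | rewrite ephi].
have cD : {within `[0, 1], continuous
    ((fun s => (f s).1) - ((fun t => (g t).1) \o phi))}.
  apply: within_continuousB => //.
  exact: (within_continuous_comp_homo cphi cg1).
have [] := @IVT R _ 0 1 0 ler01 cD.
  rewrite !fctE /= phi0 phi1 ge_min le_max !subr_ge0 !subr_le0.
  by rewrite (ltW lt0) (ltW lt1) orbT.
move=> s ms /eqP; rewrite fctE subr_eq0 => /eqP es.
exists s, (phi s); split=> //; first exact: mphi.
by rewrite (surjective_pairing (f s)) es -ephi // [RHS]surjective_pairing.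
Qed.

Lemma monotone_curves_meet f g :
  {within `[0, 1], continuous f} -> {within `[0, 1], continuous g} ->
  vertically_monotone f -> vertically_monotone g ->
  (f 0).2 = (g 0).2 -> (f 1).2 = (g 1).2 ->
  (f 0).1 < (g 0).1 -> (g 1).1 < (f 1).1 ->
  exists s t : R, [/\ s \in `[0, 1], t \in `[0, 1] & f s = g t].
Proof.
move=> cf cg vf vg e0 e1 lt0 lt1.
have m0 : (0 : R) \in `[0, 1] by rewrite in_itv /= lexx ler01.
have m1 : (1 : R) \in `[0, 1] by rewrite in_itv /= lexx ler01.
case: vf vg => mf [] mg.
- exact: increasing_curves_meet.
(* Curves with the same initial and the same final height cannot run in opposite vertical
   directions. *)
- have := mf 0 1 m0 m1 ltr01; have := mg 0 1 m0 m1 ltr01.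
  by rewrite e0 e1 => /lt_trans /[apply]; rewrite ltxx.
- have := mf 0 1 m0 m1 ltr01; have := mg 0 1 m0 m1 ltr01.
  by rewrite e0 e1 => /lt_trans /[apply]; rewrite ltxx.
(* Both curves are decreasing: reflect the plane in the horizontal axis. *)
pose flip (h : R -> R * R) t := ((h t).1, - (h t).2).
have cflip (h : R -> R * R) :
    {within `[0, 1], continuous h} -> {within `[0, 1], continuous (flip h)}.
  move=> ch.
  apply: (@within_continuous_comp _ _ _ _ h (fun p => (p.1, - p.2))) => // x _.
  apply: (@cvg_pair _ _ _ (nbhs x) (nbhs x.1) (nbhs (- x.2))).
    exact: cvg_fst.
  by apply: cvgN; exact: cvg_snd.
have [||||||s [t [ms mt [e e']]]] :=
  @increasing_curves_meet (flip f) (flip g) _ _ _ _ _ _ lt0 lt1;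
  try exact: cflip.
- by move=> s t ms mt st; rewrite ltrN2; exact: mf.
- by move=> s t ms mt st; rewrite ltrN2; exact: mg.
- by rewrite /= e0.
- by rewrite /= e1.
exists s, t; split=> //.
rewrite (surjective_pairing (f s)) e (oppr_inj e').
by rewrite -surjective_pairing.
Qed.
End Meet.

(** * Ranks *)

Section Rank.
Variables (R : realType) (V : finType) (pos : V -> R * R).
Hypothesis pos_inj : injective pos.

Definition left_of (v : V) : {set V} :=
  [set w | ((pos w).2 == (pos v).2) && ((pos w).1 < (pos v).1)]%SET.

Definition layer_rank (v : V) : nat := #|left_of v|.

(** On one layer the sets [left_of] are nested, strictly so because [u] belongs to [left_of w] but
    not to [left_of u]. *)
Lemma layer_rank_lt u w :
  (pos u).2 = (pos w).2 ->
  (layer_rank u < layer_rank w)%N = ((pos u).1 < (pos w).1).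
Proof.
move=> e; apply/idP/idP => [|lt].
  apply: contraTT; rewrite -leNgt -leqNgt => le.
  apply/subset_leq_card/fintype.subsetP.
  by move=> x; rewrite !inE e => /andP[-> /lt_le_trans ->].
apply/proper_card/properP; split.
  apply/fintype.subsetP => x; rewrite !inE e => /andP[-> h]; exact: lt_trans lt.
by exists u; rewrite !inE ?e ?eqxx ?ltxx ?lt.
Qed.

Lemma layer_rank_inj u w :
  (pos u).2 = (pos w).2 -> layer_rank u = layer_rank w -> u = w.
Proof.
move=> e er; apply: pos_inj; rewrite (surjective_pairing (pos u)) e.
have := layer_rank_lt e; have := layer_rank_lt (esym e).
rewrite er ltnn; by case: ltgtP => // <- _ _; rewrite -surjective_pairing.
Qed.

(** Adding each vertex to its own [left_of] gives two sets at different heights, hence disjoint. *)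
Lemma layer_rank_sum u w :
  (pos u).2 != (pos w).2 -> (layer_rank u + layer_rank w + 2 <= #|V|)%N.
Proof.
move=> ne.
have card v : (layer_rank v).+1 = #|v |: left_of v|%SET.
  by rewrite cardsU1 !inE ltxx andbF.
have layer v x : x \in (v |: left_of v)%SET -> (pos x).2 = (pos v).2.
  by rewrite !inE => /orP[/eqP-> | /andP[/eqP]].
have e0 : (u |: left_of u)%SET :&: (w |: left_of w)%SET = finset.set0.
  apply/eqP/set0Pn => -[x /setIP[/layer e /layer e']].
  by move: ne; rewrite -e -e' eqxx.
rewrite addn2 -addSn -addnS !card -cardsUI e0 cards0 addn0.
exact: max_card.
Qed.

End Rank.

Lemma sum_le_two_ends_one m (c : nat -> nat) :
  (forall i, (i <= m.+1)%N -> (c i <= 2)%N) ->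
  (c 0 <= 1)%N -> (c m.+1 <= 1)%N ->
  (\sum_(i < m.+2) c i <= 2 * m.+1)%N.
Proof.
move=> c2 c0 cm.
have mid : (\sum_(i < m) c (1 + i) <= m * 2)%N.
  rewrite -[m in (m * _)%N]card_ord -sum_nat_const.
  by apply: leq_sum => i _; apply: c2; rewrite add1n ltnS ltnW.
rewrite big_ord_recl big_ord_recr /= /bump /=.
rewrite addnCA mulnC mulSn [leqRHS]addnC leq_add //; exact: leq_add c0 cm.
Qed.

(** * The upper bound: counting edges by rank *)

Section UpperBound.
Variables (R : realType) (V : finType) (adj : rel V).
Variables (pos : V -> R * R) (arc : V -> V -> R -> R * R).

(** The arcs meet because their ends are in opposite orders on the two layers. As the four ends are
    distinct, simplicity leaves only a proper crossing at the common point. *)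
Lemma swapped_edges_cross u v w z :
  two_layer_fan_planar_drawing adj pos arc -> adj u v -> adj w z ->
  (pos u).2 = (pos w).2 -> (pos v).2 = (pos z).2 ->
  (pos u).1 < (pos w).1 -> (pos z).1 < (pos v).1 ->
  [/\ independent_edges u v w z, cross (arc u v) (arc w z) &
      cross (arc w z) (arc u v)].
Proof.
move=> [[[drw simp] _ _] [y1 [y2 [_ _ mon]]]] auv awz euw evz ltuw ltzv.
have [[cuv _] uv0 uv1 _] := drw.2 _ _ auv.
have [[cwz _] wz0 wz1 _] := drw.2 _ _ awz.
have [neuv muv] := mon _ _ auv.
have [newz mwz] := mon _ _ awz.
have [||||s [t [ms mt est]]] := monotone_curves_meet cuv cwz muv mwz;
  rewrite ?uv0 ?uv1 ?wz0 ?wz1 //.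
(* Ends on the same layer differ by their abscissas, ends on different layers by their heights. *)
have dis : independent_edges u v w z.
  apply/pred0P => x /=; apply/negP => /andP[]; rewrite !inE.
  case/orP=> /eqP->; case/orP=> /eqP e; move: ltuw ltzv neuv newz;
    by rewrite ?e ?ltxx // -?euw -?evz -?e ?eqxx // euw -e eqxx.
have noI := disjoint_setI0 dis.
have ne : [set u; v]%SET != [set w; z]%SET.
  by apply/eqP => e; move/finset.setP/(_ w): noI; rewrite e !inE eqxx.
have [_ /(_ (arc u v s))] := simp _ _ _ _ auv awz ne.
(* [cross] straightens only its first argument, so simplicity is invoked for both orders of the two
   edges. *)
have [_ /(_ (arc u v s))] := simp _ _ _ _ awz auv ltac:(by rewrite eq_sym).
have on1 : on_edge arc u v (arc u v s) by exists s.
have on2 : on_edge arc w z (arc u v s) by exists t.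
move=> /(_ on2 on1) h2 /(_ on1 on2) h1; split=> //.
  case: h1 => [[x]|]; last by exists (arc u v s).
  by rewrite noI inE.
case: h2 => [[x]|]; last by exists (arc u v s).
by rewrite finset.setIC noI inE.
Qed.

Lemma card_two_layer_fan_planar_drawing :
  symmetric adj -> two_layer_fan_planar_drawing adj pos arc -> (3 <= #|V|)%N ->
  (#|edge_set adj| <= 2 * #|V| - 4)%N.
Proof.
move=> sym_adj drawn n3.
have [[[[pos_inj _] _] fan _] [y1 [y2 [ne12 lay mon]]]] := drawn.
pose rank (e : V * V) := (layer_rank pos e.1 + layer_rank pos e.2)%N.
(* Orienting each edge from the layer at [y1] to the layer at [y2] avoids counting it twice. *)
pose D := [set e : V * V | adj e.1 e.2 && ((pos e.1).2 == y1)]%SET.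
have inD e : e \in D -> [/\ adj e.1 e.2, (pos e.1).2 = y1 & (pos e.2).2 = y2].
  rewrite inE => /andP[ae /eqP e1]; split=> //.
  by case: (lay e.2) => // e2; have [] := mon _ _ ae; rewrite e1 e2 eqxx.
have DE : (#|edge_set adj| <= #|D|)%N.
  apply: leq_trans (leq_imset_card (fun e : V * V => [set e.1; e.2]%SET) D).
  apply/subset_leq_card/fintype.subsetP => E /imsetP[[u v]].
  rewrite inE /= => auv ->.
  case: (lay u) => eu; apply/imsetP.
    by exists (u, v) => //; rewrite inE /= auv eu eqxx.
  exists (v, u); last by rewrite finset.setUC.
  rewrite inE /= sym_adj auv; case: (lay v) => [->|ev]; first by rewrite eqxx.
  by have [] := mon _ _ auv; rewrite eu ev eqxx.
have order e e' : e \in D -> e' \in D -> rank e = rank e' -> e != e' ->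
    exists f f', [/\ f \in D, f' \in D,
      (layer_rank pos f.1 < layer_rank pos f'.1)%N,
      (layer_rank pos f'.2 < layer_rank pos f.2)%N &
      (f = e /\ f' = e') \/ (f = e' /\ f' = e)].
  move=> De De' er ne.
  have [[_ e1 e2] [_ e1' e2']] := (inD _ De, inD _ De').
  (* With equal sums, a smaller first rank forces a larger second rank; equal first ranks would make
     the two edges coincide. *)
  have [lt|lt|eq] := ltngtP (layer_rank pos e.1) (layer_rank pos e'.1).
  - exists e, e'; split=> //; last by left.
    by move: er lt; rewrite /rank; clear; lia.
  - exists e', e; split=> //; last by right.
    by move: er lt; rewrite /rank; clear; lia.
  case/eqP: ne; rewrite (surjective_pairing e) (surjective_pairing e').
  rewrite (layer_rank_inj pos_inj _ eq) ?e1 //.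
  rewrite (@layer_rank_inj _ _ _ pos_inj e.2 e'.2) ?e2 //.
  by move: er; rewrite /rank eq => /addnI.
have crossing e e' : e \in D -> e' \in D -> rank e = rank e' -> e != e' ->
    independent_edges e.1 e.2 e'.1 e'.2 /\ cross (arc e.1 e.2) (arc e'.1 e'.2).
  move=> De De' er ne.
  have [f [f' [Df Df' lt1 lt2 ff']]] := order _ _ De De' er ne.
  have [[af f1 f2] [af' f1' f2']] := (inD _ Df, inD _ Df').
  have [||||i c c'] := swapped_edges_cross drawn af af'.
  - by rewrite f1.
  - by rewrite f2.
  - by rewrite -layer_rank_lt // f1.
  - by rewrite -layer_rank_lt // f2.
  by case: ff' i c c' => -[-> ->] //; rewrite /independent_edges disjoint_sym.
pose c i := #|[set e in D | rank e == i]%SET|.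
have inC i e : e \in [set e in D | rank e == i]%SET -> e \in D /\ rank e = i.
  by rewrite inE => /andP[? /eqP].
have rank_max (u v : V) : (pos u).2 = y1 -> (pos v).2 = y2 ->
    (layer_rank pos u + layer_rank pos v + 2 <= #|V|)%N.
  by move=> eu ev; apply: layer_rank_sum; rewrite eu ev.
have c2 i : (c i <= 2)%N.
  rewrite leqNgt; apply/card_gt2P => -[x [y [z [mem [xy yz zx]]]]].
  (* Of three edges of equal rank, [x] crosses both [y] and [z], which are independent: this
     contradicts condition (a). *)
  have [/inC[Dx rx] /inC[Dy ry] /inC[Dz rz]] := mem.
  have [_ cxy] := crossing _ _ Dx Dy (etrans rx (esym ry)) xy.
  have [|_ cxz] := crossing _ _ Dx Dz (etrans rx (esym rz)).
    by rewrite eq_sym.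
  have [iyz _] := crossing _ _ Dy Dz (etrans ry (esym rz)) yz.
  have [[ax _ _] [ay _ _] [az _ _]] := And3 (inD _ Dx) (inD _ Dy) (inD _ Dz).
  by have := fan _ _ _ _ _ _ ax ay az cxy cxz; rewrite iyz.
have c_end i : i = 0%N \/ (i.+2 = #|V|)%N -> (c i <= 1)%N.
  move=> iE; rewrite leqNgt.
  apply/card_gt1P => -[x [y [/inC[Dx rx] /inC[Dy ry] xy]]].
  have [f [f' [Df Df' lt1 lt2 ff']]] :=
    order _ _ Dx Dy (etrans rx (esym ry)) xy.
  have [[_ f1 f2] [_ f1' f2']] := (inD _ Df, inD _ Df').
  have rf : rank f = i by case: ff' => -[-> _].
  (* The pair [(f'.1, f.2)], perhaps not an edge, has a rank sum exceeding [i], which rules out the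
     maximal [i]. For [i = 0], [lt2] already makes the rank of [f] positive. *)
  have := rank_max _ _ f1' f2.
  by move: rf lt1 lt2 iE; rewrite /rank; clear; lia.
(* The possible ranks are then 0 to [m.+1], and the bound [2 * m.+1] equals [2 * #|V| - 4]. *)
have [m mE] : exists m, #|V| = m.+3 by exists (#|V| - 3)%N; clear -n3; lia.
apply: leq_trans DE _; suff -> : #|D| = (\sum_(i < m.+2) c i)%N.
  have c0 := c_end 0%N (or_introl erefl).
  have cm := c_end m.+1 (or_intror (esym mE)).
  rewrite mE; have := sum_le_two_ends_one (fun i _ => c2 i) c0 cm.
  by clear; lia.
rewrite -sum1_card.
(* By [rank_max] no rank exceeds [m.+1], so [inord] does not alter it. *)
rewrite (partition_big (fun e => inord (rank e) : 'I_m.+2) xpredT) //=.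
apply: eq_bigr => i _; rewrite /c -sum1_card; apply: eq_bigl => e.
rewrite [in RHS]inE; apply: andb_id2l => De; have [_ e1 e2] := inD _ De.
rewrite -val_eqE /= inordK //; have := rank_max _ _ e1 e2.
by rewrite mE /rank; clear; lia.
Qed.

End UpperBound.

(** * Straight-line drawings *)

Section Segments.
Variable R : realType.
Implicit Types (p q r s : R * R) (t : R).

Definition segment p q t : R * R :=
  (p.1 + t * (q.1 - p.1), p.2 + t * (q.2 - p.2)).

(* Maps p to (0, 0) and q to (1, 0); the second coordinate is a cross product. *)
Definition straightening p q (x : R * R) : R * R :=
  ((x.2 - p.2) / (q.2 - p.2),
   (q.1 - p.1) * (x.2 - p.2) - (q.2 - p.2) * (x.1 - p.1)).

(** The cross product of the directions of the two segments, zero exactly when these are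
    parallel. *)
Definition slope_det p q r s : R :=
  (q.1 - p.1) * (s.2 - r.2) - (q.2 - p.2) * (s.1 - r.1).

Lemma continuous_pairR (T : topologicalType) (f g : T -> R) :
  continuous f -> continuous g -> continuous (fun x => (f x, g x)).
Proof.
move=> cf cg x.
by apply: (@cvg_pair _ _ _ (nbhs x) (nbhs (f x)) (nbhs (g x)));
  [exact: cf|exact: cg].
Qed.

Lemma continuous_affine2 (a b c : R) :
  continuous (fun x : R * R => a + b * x.1 + c * x.2).
Proof.
move=> x; apply: cvgD; first apply: cvgD; first exact: cvg_cst.
  by apply: cvgM; [exact: cvg_cst | exact: cvg_fst].
by apply: cvgM; [exact: cvg_cst | exact: cvg_snd].
Qed.

Lemma continuous_segment p q : continuous (segment p q).
Proof.
by apply: continuous_pairR => x; apply: cvgD; try exact: cvg_cst;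
  apply: cvgM; try exact: cvg_cst; exact: cvg_id.
Qed.

Lemma segment_rev p q t : segment q p t = segment p q (1 - t).
Proof. by rewrite /segment; congr pair; ring. Qed.

Lemma segment0 p q : segment p q 0 = p.
Proof. by rewrite /segment !mul0r !addr0 -surjective_pairing. Qed.

Lemma segment1 p q : segment p q 1 = q.
Proof. by rewrite segment_rev subrr segment0. Qed.

(** The map is affine of determinant 1, and relative height parametrizes a segment that is not
    horizontal. *)
Lemma straightens_segment p q :
  p.2 != q.2 -> straightens (straightening p q) (segment p q).
Proof.
move=> ne; have d0 : q.2 - p.2 != 0 by rewrite subr_eq0 eq_sym.
split; last first.
  by move=> t _; rewrite /straightening /segment /=; congr pair; [field | ring].
split.
  apply: continuous_pairR.
    rewrite (_ : (fun x => _) = fun x : R * R =>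
      (- p.2 / (q.2 - p.2)) + 0 * x.1 + (q.2 - p.2)^-1 * x.2).
      exact: continuous_affine2.
    by apply/funext => x; ring.
  rewrite (_ : (fun x => _) = fun x : R * R =>
    ((q.2 - p.2) * p.1 - (q.1 - p.1) * p.2) + (- (q.2 - p.2)) * x.1 +
    (q.1 - p.1) * x.2); first exact: continuous_affine2.
  by apply/funext => x; ring.
exists (fun y => (p.1 + (q.1 - p.1) * y.1 - y.2 / (q.2 - p.2),
                  p.2 + (q.2 - p.2) * y.1)).
split.
- apply: continuous_pairR.
    rewrite (_ : (fun x => _) = fun x : R * R =>
      p.1 + (q.1 - p.1) * x.1 + (- (q.2 - p.2)^-1) * x.2).
      exact: continuous_affine2.
    by apply/funext => x; ring.
  rewrite (_ : (fun x => _) = fun x : R * R =>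
    p.2 + (q.2 - p.2) * x.1 + 0 * x.2); first exact: continuous_affine2.
  by apply/funext => x; ring.
- by move=> [x y]; rewrite /straightening /=; congr pair; field.
- by move=> [x y]; rewrite /straightening /=; congr pair; field.
Qed.

Lemma straightening_segment p q r s t :
  (straightening p q (segment r s t)).2 =
  (straightening p q r).2 + t * slope_det p q r s.
Proof. by rewrite /straightening /segment /slope_det /=; ring. Qed.

(** After straightening, the second coordinate along [segment r s] is affine with slope
    [slope_det p q r s] and root [b], so it changes sign there. *)
Lemma segments_cross p q r s (a b : R) :
  p.2 != q.2 -> slope_det p q r s != 0 -> a \in `]0, 1[ -> b \in `]0, 1[ ->
  segment p q a = segment r s b ->
  properly_cross_at (segment p q) (segment r s) (segment p q a).
Proof.
move=> ne m0 ma mb eab; have st := straightens_segment ne.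
(* A positive slope means arriving from the lower side, which is encoded by [true]. *)
exists (straightening p q), (0 < slope_det p q r s); split=> //.
exists a, b; split; first by split.
have ma' : a \in `[0, 1] by exact: subset_itv_oo_cc.
have e0 : (straightening p q r).2 + b * slope_det p q r s = 0.
  by rewrite -straightening_segment -eab st.2.
have val t : (straightening p q (segment r s t)).2 =
    (t - b) * slope_det p q r s.
  by rewrite straightening_segment -[LHS]subr0 -e0; ring.
have sgn : (-1) ^+ (0 < slope_det p q r s)%R * slope_det p q r s < 0.
  have [lt|le] := ltP 0 (slope_det p q r s).
    by rewrite expr1 mulN1r oppr_lt0.
  by rewrite expr0 mul1r lt_neqAle m0.
split; near=> x; rewrite val mulrCA.
  by rewrite nmulr_lgt0 // subr_lt0; near: x; exact: nbhs_left_lt.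
by rewrite nmulr_llt0 // subr_gt0; near: x; exact: nbhs_right_gt.
Unshelve. all: by end_near. Qed.

(* A segment starting at r can cross the line pq only away from the side of r. *)
Lemma segment_fan_same_side p q r s s' :
  p.2 != q.2 ->
  ~ cross_from_different_sides (segment p q) (segment r s) (segment r s').
Proof.
move=> ne [_ _ /(_ _ (straightens_segment ne))[b [x [y [c c']]]]].
have side s0 z b0 :
    crosses_from_at (straightening p q) b0 (segment p q) (segment r s0) z ->
    0 < (-1) ^+ b0 * (straightening p q r).2.
  move=> [a [t [[ma mt ea et] [near_t _]]]].
  have ma' : a \in `[0, 1] by exact: subset_itv_oo_cc.
  have e0 : (straightening p q r).2 + t * slope_det p q r s0 = 0.
    by rewrite -straightening_segment et -ea (straightens_segment ne).2.
  have t0 : 0 < t by move: mt; rewrite in_itv /= => /andP[].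
  (* The straightened height at parameter [u] is [(u - t)] times the slope. Since [0 < t], it has
     the same sign just before [t] as at parameter 0, that is, at [r]. *)
  near (t^'-) => u.
  have ut : u < t by near: u; exact: nbhs_left_lt.
  have : 0 < (-1) ^+ b0 * (straightening p q (segment r s0 u)).2 by near: u.
  rewrite straightening_segment.
  have -> : (straightening p q r).2 = - (t * slope_det p q r s0) by lra.
  have -> : (-1) ^+ b0 * (- (t * slope_det p q r s0) + u * slope_det p q r s0) =
      (u - t) * ((-1) ^+ b0 * slope_det p q r s0) by ring.
  rewrite nmulr_rgt0 ?subr_lt0 // => k0.
  by rewrite mulrN mulrCA oppr_gt0 pmulr_rlt0.
have := side _ _ _ c; have := side _ _ _ c'.
by rewrite signrN mulNr oppr_gt0 => /lt_trans /[apply]; rewrite ltxx.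
Unshelve. all: by end_near. Qed.

End Segments.

(** * Straight-line drawings with layers at heights 0 and 1 *)

Section StraightLineDrawing.
Variables (R : realType) (V : finType) (adj : rel V).
Variables (top : V -> bool) (pos : V -> R * R).
Hypothesis pos_inj : injective pos.
Hypothesis pos2 : forall v, (pos v).2 = (top v)%:R.
Hypothesis adj_top : forall u v, adj u v -> top u != top v.

Let arc u v := segment (pos u) (pos v).

(** Naming the ends by layer describes an edge independently of its orientation: the abscissa
    becomes an affine function of the height. *)
Let top_end u v := if top u then u else v.
Let bot_end u v := if top u then v else u.

Lemma ends_set u v : [set u; v]%SET = [set top_end u v; bot_end u v]%SET.
Proof.
by rewrite /top_end /bot_end; case: ifP => // _; rewrite finset.setUC.
Qed.

Lemma adj_pos2 u v : adj u v -> (pos u).2 != (pos v).2.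
Proof. by move/adj_top; rewrite !pos2 eqr_nat; case: (top u); case: (top v). Qed.

Lemma on_straight_edge u v p : adj u v -> on_edge arc u v p ->
  0 <= p.2 <= 1 /\
  p.1 = (pos (bot_end u v)).1 +
        p.2 * ((pos (top_end u v)).1 - (pos (bot_end u v)).1).
Proof.
move=> /adj_top tuv [t]; rewrite in_itv /= => /andP[t0 t1] <-.
rewrite /arc /segment /= !pos2 /top_end /bot_end.
by move: tuv; case: (top u); case: (top v) => //= _;
  (split; last by ring); apply/andP; split; lra.
Qed.

Lemma pos_eq u v : top u = top v -> (pos u).1 = (pos v).1 -> u = v.
Proof.
move=> tE e; apply: pos_inj.
by rewrite (surjective_pairing (pos u)) e pos2 tE -pos2 -surjective_pairing.
Qed.

Lemma top_top_end u v : adj u v -> top (top_end u v).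
Proof. by move/adj_top; rewrite /top_end; case: ifP => //; case: (top v). Qed.

Lemma top_bot_end u v : adj u v -> top (bot_end u v) = false.
Proof.
by move/adj_top; rewrite /bot_end; case: ifP => //; case: (top v).
Qed.

Lemma top_end_eq u v w z : adj u v -> adj w z ->
  (pos (top_end u v)).1 = (pos (top_end w z)).1 -> top_end u v = top_end w z.
Proof. by move=> a a'; apply: pos_eq; rewrite !top_top_end. Qed.

Lemma bot_end_eq u v w z : adj u v -> adj w z ->
  (pos (bot_end u v)).1 = (pos (bot_end w z)).1 -> bot_end u v = bot_end w z.
Proof. by move=> a a'; apply: pos_eq; rewrite !top_bot_end. Qed.

(** The two equations compare the slope and the intercept of the abscissa as a function of
    height. *)
Lemma straight_edge_eq u v w z : adj u v -> adj w z ->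
  (pos (top_end u v)).1 - (pos (bot_end u v)).1 =
    (pos (top_end w z)).1 - (pos (bot_end w z)).1 ->
  (pos (bot_end u v)).1 = (pos (bot_end w z)).1 ->
  [set u; v]%SET = [set w; z]%SET.
Proof.
move=> a a' ed eb; rewrite ends_set [RHS]ends_set (bot_end_eq a a' eb).
by rewrite (top_end_eq a a') //; move: ed eb; lra.
Qed.

Lemma straight_line_drawing : symmetric adj -> drawing adj pos arc.
Proof.
move=> sym; split=> // u v auv; split.
- split; first exact/continuous_subspaceT/continuous_segment.
  move=> s t _ _ /(congr1 snd) /= /addrI /mulIf; apply.
  by rewrite subr_eq0 eq_sym adj_pos2.
- exact: segment0.
- exact: segment1.
by move=> t _; exact: segment_rev.
Qed.

(** Two affine functions of the height that agree at two heights coincide. A common point at height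
    0 or 1 is a shared vertex; at any other height the segments cross, not being parallel. *)
Lemma straight_line_simple_drawing : symmetric adj -> simple_drawing adj pos arc.
Proof.
move=> sym; split; first exact: straight_line_drawing.
move=> u v w z auv awz ne; split.
  move=> p q /(on_straight_edge auv)[_ ep] /(on_straight_edge awz)[_ ep'].
  move=> /(on_straight_edge auv)[_ eq] /(on_straight_edge awz)[_ eq'].
  have [e2|n2] := eqVneq p.2 q.2.
    by rewrite (surjective_pairing p) ep e2 -eq -surjective_pairing.
  have ed : (pos (top_end u v)).1 - (pos (bot_end u v)).1 =
    (pos (top_end w z)).1 - (pos (bot_end w z)).1.
    have n2' : p.2 - q.2 != 0 by rewrite subr_eq0.
    apply: (mulfI n2'); rewrite !mulrBl.
    move: ep ep' eq eq'; lra.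
  case/eqP: ne; apply: straight_edge_eq => //.
  by move: ep' ; rewrite ep ed => /addIr.
move=> p onp onp'; have [/andP[p0 p1] ep] := on_straight_edge auv onp.
have [_ ep'] := on_straight_edge awz onp'.
rewrite [[set u; v]%SET]ends_set [[set w; z]%SET]ends_set.
have [p1E|p1'] := eqVneq p.2 1.
  left; exists (top_end u v).
    rewrite finset.in_setI set21 /= (@top_end_eq _ _ w z) ?set21 //.
    by move: ep ep'; rewrite p1E; lra.
  by rewrite [LHS]surjective_pairing [RHS]surjective_pairing ep p1E pos2 top_top_end //;
    congr pair; ring.
have [p0E|p0'] := eqVneq p.2 0.
  left; exists (bot_end u v).
    rewrite finset.in_setI set22 /= (@bot_end_eq _ _ w z) ?set22 //.
    by move: ep ep'; rewrite p0E; lra.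
  by rewrite [LHS]surjective_pairing [RHS]surjective_pairing ep p0E pos2 top_bot_end //;
    congr pair; ring.
right.
have inner x y : adj x y -> on_edge arc x y p ->
    exists2 a, a \in `]0, 1[ & segment (pos x) (pos y) a = p.
  move=> axy [a]; rewrite in_itv /= => /andP[a0 a1] ea; exists a => //.
  rewrite in_itv /= !lt_neqAle a0 a1 !andbT; apply/andP; split.
    apply/eqP => aE; move: p0' p1'; rewrite -ea -aE /arc segment0 pos2.
    by case: (top x); rewrite eqxx.
  apply/eqP => aE; move: p0' p1'; rewrite -ea aE /arc segment1 pos2.
  by case: (top y); rewrite eqxx.
have [a ma ea] := inner _ _ auv onp; have [b mb eb] := inner _ _ awz onp'.
rewrite -ea; apply: (segments_cross _ _ ma mb); rewrite ?ea ?eb //.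
  exact: adj_pos2.
(* Parallel edges through the common point [p] would be the same edge. *)
apply: contra ne => /eqP m0; apply/eqP.
have ed : (pos (top_end u v)).1 - (pos (bot_end u v)).1 =
    (pos (top_end w z)).1 - (pos (bot_end w z)).1.
  move: m0 (adj_top auv) (adj_top awz); rewrite /slope_det /top_end /bot_end !pos2.
  by case: (top u); case: (top v); case: (top w); case: (top z) => //=; lra.
by apply: straight_edge_eq => //; move: ep'; rewrite ep ed => /addIr.
Qed.

(** A shared end-vertex would be a second common point, since a crossing lies strictly between the
    layers. *)
Lemma straight_line_cross_independent u v w z : symmetric adj ->
  adj u v -> adj w z -> cross (arc u v) (arc w z) -> independent_edges u v w z.
Proof.
move=> sym auv awz [p [H [b [st [s [t [[ms mt es et] [near_t _]]]]]]]].
have onuv : on_edge arc u v p by exists s => //; exact: subset_itv_oo_cc.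
have onwz : on_edge arc w z p by exists t => //; exact: subset_itv_oo_cc.
(* If the edges were equal, points of [arc w z] near the crossing would lie on [arc u v], where [H]
   has second coordinate 0 and no strict sign is possible. *)
have ne : [set u; v]%SET != [set w; z]%SET.
  have /andP[t0 t1] : 0 < t < 1 by move: mt; rewrite in_itv.
  apply/eqP => e; near (t^'-) => x.
  have mx : x \in `[0, 1].
    rewrite in_itv /=; apply/andP; split.
      by apply: ltW; near: x; exact: nbhs_left_gt.
    by apply: le_trans (ltW t1); apply: ltW; near: x; exact: nbhs_left_lt.
  have : 0 < (-1) ^+ b * (H (arc w z x)).2 by near: x.
  have [y my <-] : on_edge arc u v (arc w z x).
    have : w \in [set u; v]%SET by rewrite e set21.
    have : z \in [set u; v]%SET by rewrite e set22.
    have := adj_top awz; rewrite !inE => tn /orP[]/eqP zE /orP[]/eqP wE;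
      move: tn; rewrite zE wE ?eqxx // => _; last by exists x.
    exists (1 - x); last by rewrite /arc [RHS]segment_rev.
    by move: mx; rewrite !in_itv /= => /andP[? ?]; apply/andP; split; lra.
  by rewrite st.2 //= mulr0 ltxx.
have [uniq_meet _] := (straight_line_simple_drawing sym).2 _ _ _ _ auv awz ne.
have end_on x y k : adj x y -> k \in [set x; y]%SET -> on_edge arc x y (pos k).
  move=> axy; rewrite !inE => /orP[]/eqP->.
    by exists 0; [rewrite in_itv /= lexx ler01 | exact: segment0].
  by exists 1; [rewrite in_itv /= lexx ler01 | exact: segment1].
apply/pred0P => k /=; apply/negP => /andP[kuv kwz].
have pk := uniq_meet _ _ onuv onwz (end_on _ _ _ auv kuv) (end_on _ _ _ awz kwz).
move: ms (adj_top auv) (congr1 snd pk).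
rewrite -es /= !pos2 in_itv /= => /andP[s0 s1].
by case: (top u); case: (top v); case: (top k) => //= _; lra.
Unshelve. all: by end_near. Qed.

(** Crossing segments are independent, so condition (a) reduces to the absence of three pairwise
    independent edges; condition (b) holds for all segments. *)
Lemma straight_line_two_layer_fan_planar : symmetric adj ->
  (forall x y u v w z, adj x y -> adj u v -> adj w z ->
     independent_edges x y u v -> independent_edges x y w z ->
     ~~ independent_edges u v w z) ->
  two_layer_fan_planar_drawing adj pos arc.
Proof.
move=> sym fan; split; first split.
- exact: straight_line_simple_drawing.
- move=> x y u v w z axy auv awz /(straight_line_cross_independent sym axy auv) i.
  move=> /(straight_line_cross_independent sym axy awz) i'; exact: fan i i'.
- by move=> x y u v w axy _ _ _; apply: segment_fan_same_side; exact: adj_pos2.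
exists 1, 0; split; first exact: oner_neq0.
  by move=> v; rewrite pos2; case: (top v); [left|right].
move=> u v auv; split; first exact: adj_pos2.
move: (adj_top auv); rewrite /arc /segment /vertically_monotone /= !pos2.
case: (top u); case: (top v) => // _; [right|left] => s t _ _ st /=; lra.
Qed.

End StraightLineDrawing.

(** * Tightness: the complete bipartite graph with parts of sizes 2 and [m] *)

Section CompleteBipartite.
Variables (R : realType) (m : nat).
Let V := (bool + 'I_m)%type.

Definition is_top (v : V) : bool := if v is inl _ then true else false.

Definition K2m_adj : rel V := fun u v => is_top u != is_top v.

Definition K2m_pos (v : V) : R * R :=
  match v with inl b => (b%:R, 1) | inr i => ((i : nat)%:R, 0) end.

Lemma K2m_two_layer_fan_planar : two_layer_fan_planar R K2m_adj.
Proof.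
exists K2m_pos, (fun u v => segment (K2m_pos u) (K2m_pos v)).
apply: (@straight_line_two_layer_fan_planar _ _ _ is_top) => //.
- move=> u v uv; move: (congr1 snd uv) (congr1 fst uv) => {uv}.
  case: u v => [b|i] [b'|i'] /= /eqP;
    rewrite ?oner_eq0 // 1?eq_sym ?oner_eq0 // => _ /eqP.
    by rewrite eqr_nat; case: b; case: b'.
  by rewrite eqr_nat => /eqP/val_inj->.
- by case.
- by move=> u v; rewrite /K2m_adj eq_sym.
(* Every edge contains one of the two top vertices, so by pigeonhole two of any three edges share
   one. *)
have has_top u v : K2m_adj u v -> exists b, inl b \in [set u; v]%SET.
  by case: u v => [b|i] [b'|i'] // _;
    [exists b | exists b']; rewrite !inE eqxx ?orbT.
move=> x y u v w z /has_top[b1 h1] /has_top[b2 h2] /has_top[b3 h3].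
have neq (A B : {set V}) b b' : inl b \in A -> inl b' \in B ->
    [disjoint A & B]%B -> b != b'.
  by move=> hA hB dis; apply: contraTneq hB => <-; rewrite (disjointFr dis hA).
move=> /(neq _ _ _ _ h1 h2) n12 /(neq _ _ _ _ h1 h3) n13.
apply/negP => /(neq _ _ _ _ h2 h3).
by case: b1 b2 b3 n12 n13 {h1 h2 h3} => [] [] [].
Qed.

Lemma card_K2m_edge_set : #|edge_set K2m_adj| = (2 * m)%N.
Proof.
pose e (x : bool * 'I_m) : {set V} := [set inl x.1; inr x.2]%SET.
have e_inj : injective e.
  move=> [b i] [b' i'] eE.
  have : inl b \in e (b', i') by rewrite -eE set21.
  have : inr i \in e (b', i') by rewrite -eE set22.
  by rewrite !inE /= => /eqP[->] /orP[/eqP[->]|].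
rewrite -card_bool -[in RHS](card_ord m) -card_prod -(card_imset predT e_inj).
apply: eq_card => E; apply/imsetP/imsetP => [[[[b|i] [b'|i']]]|[[b i] _ ->]].
- by rewrite inE.
- by move=> _ ->; exists (b, i').
- by move=> _ ->; exists (b', i) => //; rewrite /= finset.setUC.
- by rewrite inE.
by exists (inl b, inr i); rewrite ?inE.
Qed.

End CompleteBipartite.

Theorem theorem2 (R : realType) (n : nat) (hn : (3 <= n)%N) :
  (forall (V : finType) (adj : rel V),
     simple_graph adj -> #|V| = n -> two_layer_fan_planar R adj ->
     (#|edge_set adj| <= 2 * n - 4)%N) /\
  (exists (V : finType) (adj : rel V),
     [/\ simple_graph adj, #|V| = n, two_layer_fan_planar R adj &
         #|edge_set adj| = (2 * n - 4)%N]).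
Proof.
split=> [V adj [sym _] Vn [pos [arc drawn]]|].
  by rewrite -Vn; apply: (card_two_layer_fan_planar_drawing sym drawn); rewrite Vn.
exists (bool + 'I_(n - 2))%type, (@K2m_adj (n - 2)); split.
- by split=> [u v|u]; rewrite /K2m_adj ?eqxx // eq_sym.
- by rewrite card_sum card_bool card_ord; lia.
- exact: K2m_two_layer_fan_planar.
- by rewrite card_K2m_edge_set; lia.
Qed.
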